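(* Let $X$ be any topological space, $\mathbf M$ the $\sigma$-ideal of meager subsets of $X$, and $\Gamma=\{[F]: F\subseteq X\text{ closed}\}\subseteq \wp(X)/\mathbf M$. Then $\Gamma$ is relatively complete in $\wp(X)/\mathbf M$: for every $a\in\wp(X)/\mathbf M$, the set $\{g\in\Gamma : a\sqsubseteq g\}$ has a least element.
   Context: A subset of $X$ is nowhere dense if the interior of its closure is empty, and meager if it is a countable union of nowhere dense sets. $\wp(X)/\mathbf M$ is the quotient Boolean algebra of the powerset of $X$ modulo the meager sets; $[A]$ denotes the class of $A\subseteq X$, and $[A]\sqsubseteq[B]$ iff $A\setminus B$ is meager. *)

(* Defs.v *)
From HB Require Import structures.
From mathcomp Require Import all_boot all_order.
From mathcomp Require Import boolp classical_sets topology.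

Set Implicit Arguments.
Unset Strict Implicit.
Unset Printing Implicit Defensive.

Import Order.TTheory.
Local Open Scope classical_set_scope.
Local Open Scope quotient_scope.

Section Meager.
Variable X : topologicalType.
Implicit Types A B : set X.

Definition nowhere_dense A := interior (closure A) = set0.

(* [set0] is nowhere dense, so [nat]-indexed unions cover finite ones too. *)
Definition meager A :=
  exists2 F : nat -> set X, (forall n, nowhere_dense (F n)) & A = \bigcup_n F n.

Lemma nowhere_dense0 : nowhere_dense set0.
Proof. by rewrite /nowhere_dense closure0 interior0. Qed.

Lemma nowhere_denseS A B : A `<=` B -> nowhere_dense B -> nowhere_dense A.
Proof.
move=> AB B0; rewrite /nowhere_dense -subset0 -B0.
exact/interiorS/closureS.
Qed.

Lemma meager_set0 : meager set0.
Proof.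
by exists (fun=> set0) => [_|]; [exact: nowhere_dense0|rewrite bigcup0].
Qed.

Lemma meager_subset A B : A `<=` B -> meager B -> meager A.
Proof.
move=> AB [F Fnd BF]; exists (fun n => A `&` F n).
  by move=> n; apply: nowhere_denseS (Fnd n); exact: subIsetr.
by rewrite -setI_bigcupr -BF; apply/esym/setIidPl.
Qed.

Lemma meager_bigcup (F : nat -> set X) :
  (forall n, meager (F n)) -> meager (\bigcup_n F n).
Proof.
move=> mF; have [G Gnd FG] := all_sig2 (fun n => cid2 (mF n)).
exists (fun n => if unpickle n is Some ij then G ij.1 ij.2 else set0).
  by move=> n; case: unpickle => [ij|]; [exact: Gnd|exact: nowhere_dense0].
apply/seteqP; split=> x.
  move=> [i _]; rewrite FG => -[j _ Gx].
  by exists (pickle (i, j)) => //; rewrite pickleK.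
by move=> [n _]; case: unpickle => // -[i j] Gx; exists i => //; rewrite FG; exists j.
Qed.

Lemma meager_setU A B : meager A -> meager B -> meager (A `|` B).
Proof.
move=> mA mB; rewrite -bigcup2E; apply: meager_bigcup => -[|[|n]] //=.
exact: meager_set0.
Qed.

Definition meager_equiv A B : bool := `[< meager (A `+` B) >].

Lemma meager_setY A B :
  meager (A `+` B) <-> meager (A `\` B) /\ meager (B `\` A).
Proof.
rewrite setY_def; split => [m|[]]; last exact: meager_setU.
by split; apply: meager_subset m; [exact: subsetUl|exact: subsetUr].
Qed.

Lemma meager_setD_trans A B C :
  meager (A `\` B) -> meager (B `\` C) -> meager (A `\` C).
Proof.
move=> mAB mBC; apply: meager_subset (meager_setU mAB mBC) => x [Ax nCx].
by have [Bx|nBx] := pselect (B x); [right|left].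
Qed.

Lemma meager_equiv_refl : reflexive meager_equiv.
Proof. by move=> A; apply/asboolP; rewrite setYK; exact: meager_set0. Qed.

Lemma meager_equiv_sym : symmetric meager_equiv.
Proof. by move=> A B; rewrite /meager_equiv setYC. Qed.

Lemma meager_equiv_trans : transitive meager_equiv.
Proof.
move=> B A C /asboolP/meager_setY[AB BA] /asboolP/meager_setY[BC CB].
apply/asboolP/meager_setY; split; first exact: meager_setD_trans AB BC.
exact: meager_setD_trans CB BA.
Qed.

Canonical meager_equiv_rel :=
  EquivRel meager_equiv meager_equiv_refl meager_equiv_sym meager_equiv_trans.

Definition powerset_mod_meager := {eq_quot meager_equiv}.
HB.instance Definition _ := Choice.on powerset_mod_meager.

Definition mclass A : powerset_mod_meager := \pi_({eq_quot meager_equiv}) A.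

Lemma mclassP A B : mclass A = mclass B <-> meager (A `+` B).
Proof.
split=> [/eqquotP/asboolP //|m].
by apply/eqquotP/asboolP.
Qed.

Lemma mclass_repr (a : powerset_mod_meager) : mclass (repr a) = a.
Proof. exact: reprK. Qed.

Lemma mclass_surj (a : powerset_mod_meager) : exists A, a = mclass A.
Proof. by exists (repr a); rewrite mclass_repr. Qed.

(* Independent of the chosen representatives: see [mleP]. *)
Definition mle (a b : powerset_mod_meager) : bool :=
  `[< meager (repr a `\` repr b) >].

Lemma mleP A B : mle (mclass A) (mclass B) <-> meager (A `\` B).
Proof.
have /mclassP/meager_setY[AA' A'A] := mclass_repr (mclass A).
have /mclassP/meager_setY[BB' B'B] := mclass_repr (mclass B).
split=> [/asboolP m|m]; last apply/asboolP.
  exact: meager_setD_trans (meager_setD_trans A'A m) BB'.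
exact: meager_setD_trans (meager_setD_trans AA' m) B'B.
Qed.

Lemma mle_refl : reflexive mle.
Proof. by move=> a; apply/asboolP; rewrite setDv; exact: meager_set0. Qed.

Lemma mle_anti : antisymmetric mle.
Proof.
move=> a b /andP[/asboolP ab /asboolP ba].
by rewrite -(mclass_repr a) -(mclass_repr b); apply/mclassP/meager_setY.
Qed.

Lemma mle_trans : transitive mle.
Proof.
move=> b a c /asboolP ab /asboolP bc; apply/asboolP.
exact: meager_setD_trans ab bc.
Qed.

Fact meager_display : Order.disp_t. Proof. exact: (Order.Disp tt tt). Qed.

HB.instance Definition _ := Order.Le_isPOrder.Build meager_display
  powerset_mod_meager mle_refl mle_anti mle_trans.

(* Likewise: see [meet_mclass], [join_mclass] and [compl_mclass]. *)
Definition mmeet (a b : powerset_mod_meager) := mclass (repr a `&` repr b).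
Definition mjoin (a b : powerset_mod_meager) := mclass (repr a `|` repr b).
Definition mcompl (a : powerset_mod_meager) := mclass (~` repr a).

Lemma le_mclass A B : (mclass A <= mclass B)%O <-> meager (A `\` B).
Proof. exact: mleP. Qed.

Lemma mmeetP (a b c : powerset_mod_meager) :
  (a <= mmeet b c)%O = (a <= b)%O && (a <= c)%O.
Proof.
rewrite -(mclass_repr a) -{2}(mclass_repr b) -{2}(mclass_repr c).
apply/idP/andP => [/le_mclass m|[/le_mclass mb /le_mclass mc]].
  by split; apply/le_mclass; apply: meager_subset m => x [ax nx];
    split => // -[].
apply/le_mclass; rewrite setDIr; exact: meager_setU.
Qed.

Lemma mjoinP (a b c : powerset_mod_meager) :
  (mjoin a b <= c)%O = (a <= c)%O && (b <= c)%O.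
Proof.
rewrite -(mclass_repr c) -{2}(mclass_repr a) -{2}(mclass_repr b).
apply/idP/andP => [/le_mclass m|[/le_mclass ma /le_mclass mb]].
  by split; apply/le_mclass; apply: meager_subset m => x [ax nx];
    split => //; [left|right].
apply/le_mclass; rewrite setDUl; exact: meager_setU.
Qed.

HB.instance Definition _ := Order.POrder_MeetJoin_isLattice.Build meager_display
  powerset_mod_meager mmeetP mjoinP.

Lemma le_mclass_subset A B : A `<=` B -> (mclass A <= mclass B)%O.
Proof.
by rewrite -setD_eq0 => AB; apply/le_mclass; rewrite AB; exact: meager_set0.
Qed.

Lemma meet_mclass A B : (mclass A `&` mclass B)%O = mclass (A `&` B).
Proof.
apply/le_anti/andP; split; last first.
  by rewrite lexI !le_mclass_subset.
have [D e] := mclass_surj (mclass A `&` mclass B)%O; rewrite e.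
apply/le_mclass; rewrite setDIr.
by apply: meager_setU; apply/le_mclass; rewrite -e ?leIl ?leIr.
Qed.

Lemma join_mclass A B : (mclass A `|` mclass B)%O = mclass (A `|` B).
Proof.
apply/le_anti/andP; split.
  by rewrite leUx !le_mclass_subset.
have [D e] := mclass_surj (mclass A `|` mclass B)%O; rewrite e.
apply/le_mclass; rewrite setDUl.
by apply: meager_setU; apply/le_mclass; rewrite -e ?leUl ?leUr.
Qed.

Lemma mmeetUl : left_distributive
  (@Order.meet _ powerset_mod_meager) (@Order.join _ powerset_mod_meager).
Proof.
move=> a b c; have [A ->] := mclass_surj a; have [B ->] := mclass_surj b.
have [C ->] := mclass_surj c.
by rewrite join_mclass !meet_mclass join_mclass setIUl.
Qed.

HB.instance Definition _ := Order.Lattice_Meet_isDistrLattice.Build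
  meager_display powerset_mod_meager mmeetUl.

Lemma mle0 (a : powerset_mod_meager) : (mclass set0 <= a)%O.
Proof.
rewrite -(mclass_repr a); apply/le_mclass; rewrite set0D; exact: meager_set0.
Qed.

Lemma mle1 (a : powerset_mod_meager) : (a <= mclass setT)%O.
Proof.
rewrite -(mclass_repr a); apply/le_mclass; rewrite setDT; exact: meager_set0.
Qed.

HB.instance Definition _ := Order.hasBottom.Build meager_display
  powerset_mod_meager mle0.
HB.instance Definition _ := Order.hasTop.Build meager_display
  powerset_mod_meager mle1.

Lemma mjoinxC (a : powerset_mod_meager) : (a `|` mcompl a)%O = \top%O.
Proof. by rewrite -{1}(mclass_repr a) join_mclass setUv. Qed.

Lemma mmeetxC (a : powerset_mod_meager) : (a `&` mcompl a)%O = \bot%O.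
Proof. by rewrite -{1}(mclass_repr a) meet_mclass setICr. Qed.

HB.instance Definition _ := Order.TBDistrLattice_hasComplement.Build
  meager_display powerset_mod_meager mjoinxC mmeetxC.

Lemma compl_mclass A : (~` mclass A)%O = mclass (~` A).
Proof.
have /mclassP/meager_setY[? ?] := mclass_repr (mclass A).
by apply/mclassP/meager_setY; rewrite !setDE !setCK -!(setIC (repr _)) -!(setIC A).
Qed.

Definition closed_classes : set powerset_mod_meager :=
  [set mclass F | F in [set F : set X | closed F]].

End Meager.

Arguments closed_classes : clear implicits.

Definition least d (T : porderType d) (S : set T) (g : T) := S g /\ lbound S g.

Definition relatively_complete d (B : ctbDistrLatticeType d) (G : set B) :=
  forall a : B, exists g, least [set g | G g /\ (a <= g)%O] g.

(* Main.v *)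
Require Import Defs.
From mathcomp Require Import all_boot all_order.
From mathcomp Require Import boolp classical_sets topology.

(** For a representative [A] of the given class, let [W] be the union of all
    open sets [U] such that [A `&` U] is meager. The complement of [W] is the
    smallest closed set containing [A] up to a meager set, provided that
    [A `&` W] is itself meager: this is the Banach category theorem. For the
    latter, take a maximal disjoint family of such [U]s. Its union [V] is dense
    in [W], so [W `\` V] is nowhere dense; and, for each [n], the union over the
    disjoint family of the [n]-th nowhere dense pieces of the [A `&` U] is
    nowhere dense, because within each [U] it coincides with a single piece. *)

Local Open Scope classical_set_scope.

Section BanachCategory.
Context {X : topologicalType}.
Implicit Types A U V : set X.

Lemma nowhere_denseP A :
  nowhere_dense A <->
  forall U, open U -> U `<=` closure A -> U = set0.
Proof.
split=> [A0 U oU UA|]; last first.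
  by apply; [exact: open_interior|exact: interior_subset].
by rewrite -subset0 -A0 -open_subsetE.
Qed.

Lemma open_setI_closure U A : open U -> U `&` closure A `<=` closure (U `&` A).
Proof.
move=> oU x [Ux Ax] B Bx.
have [y [Ay [Uy By]]] := Ax _ (filterI (open_nbhs_nbhs (conj oU Ux)) Bx).
by exists y.
Qed.

Lemma nowhere_dense_trivIset_bigcup (I : Type) (D : set I) (U N : I -> set X) :
  trivIset D U -> (forall i, D i -> open (U i)) ->
  (forall i, D i -> N i `<=` U i) -> (forall i, D i -> nowhere_dense (N i)) ->
  nowhere_dense (\bigcup_(i in D) N i).
Proof.
move=> tU oU NU ndN; apply/nowhere_denseP => O oO ON.
apply: contrapT => /eqP/set0P[x Ox].
have [y [[i Di Niy] Oy]] := ON _ Ox _ (open_nbhs_nbhs (conj oO Ox)).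
have UN : U i `&` \bigcup_(j in D) N j `<=` N i.
  move=> z [Uz [j Dj Njz]].
  suff -> : i = j by [].
  by apply: tU => //; exists z; split=> //; exact: NU.
(* The intersection of [U i] and [O] is open and lies in the closure of the nowhere dense [N i], so
   it is empty; yet it contains [y]. *)
have /nowhere_denseP/(_ (U i `&` O) (openI (oU _ Di) oO)) := ndN _ Di.
have UON : U i `&` O `<=` closure (N i).
  move=> z [Uz Oz]; apply: closureS UN _ _.
  by apply: open_setI_closure; [exact: oU|split=> //; exact: ON].
by move=> /(_ UON)/seteqP[/(_ y) + _]; apply; split=> //; exact: NU.
Qed.

Lemma meager_trivIset_bigcup (I : Type) (D : set I) (U : I -> set X) A :
  trivIset D U -> (forall i, D i -> open (U i)) ->
  (forall i, D i -> meager (A `&` U i)) ->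
  meager (A `&` \bigcup_(i in D) U i).
Proof.
move=> tU oU mU.
(* Keeping [D i] under the existential lets [choice] range over all of [I]; off [D] the value is a
   dummy. *)
have /choice[N NP] i : exists N : nat -> set X, D i ->
    (forall n, nowhere_dense (N n)) /\ A `&` U i = \bigcup_n N n.
  have [/mU[N ndN UN]|nDi] := pselect (D i); first by exists N.
  by exists (fun=> set0).
exists (fun n => \bigcup_(i in D) N i n) => [n|].
  apply: (nowhere_dense_trivIset_bigcup _ _ U) => // i /NP[ndN UN] //.
  by move=> x Nx; have [] : (A `&` U i) x by rewrite UN; exists n.
apply/seteqP; split=> [x [Ax [i Di Ux]]|x [n _ [i Di Nx]]].
  have : (A `&` U i) x by [].
  by rewrite (NP i Di).2 => -[n _ Nx]; exists n => //; exists i.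
have [Ax Ux] : (A `&` U i) x by rewrite (NP i Di).2; exists n.
by split=> //; exists i.
Qed.

(** A nonempty open set in the closure of the difference would miss every member of [D] but meet
    some [U] in [G]; their intersection, again in [G], could then be added to [D]. *)
Lemma maximal_disjoint_nowhere_dense (G D : set (set X)) :
  (forall U, G U -> open U) ->
  (forall U V, G U -> open V -> V `<=` U -> G V) ->
  maximal_disjoint_subcollection id D G ->
  nowhere_dense ((\bigcup_(U in G) U) `\` \bigcup_(U in D) U).
Proof.
move=> oG GS [DG tD maxD]; set W := \bigcup_(U in G) U.
set V := \bigcup_(U in D) U.
have oV : open V by apply: bigcup_open => U /DG/oG.
apply/nowhere_denseP => O oO OWV; apply: contrapT => /eqP/set0P[x Ox].
have [y [[[U GU Uy] _] Oy]] := OWV _ Ox _ (open_nbhs_nbhs (conj oO Ox)).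
have VO0 z : V z -> O z -> False.
  move=> Vz /OWV/(_ _ (open_nbhs_nbhs (conj oV Vz))).
  by case=> t [[_ ?]].
have GOU : G (O `&` U).
  by apply: (GS U) => //; apply: openI => //; exact: oG.
have dOU B : D B -> B `&` (O `&` U) !=set0 -> False.
  by move=> DB [z [Bz [Oz _]]]; apply: (VO0 z) => //; exists B.
apply: (maxD (D `|` [set O `&` U])).
- split; first exact: subsetUl.
  (* The enlargement is proper: were the new set in [D], it would have to miss itself, but it
     contains [y]. *)
  by move=> /(_ (O `&` U) (or_intror erefl)) DOU; apply: (dOU _ DOU); exists y.
- by move=> B [/DG|->].
- move=> B C [DB|->] [DC|->] //; first exact: tD.
    by move=> /(dOU _ DB).
  by rewrite setIC => /(dOU _ DC).
Qed.

Theorem Banach_category A :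
  meager (A `&` \bigcup_(U in [set U | open U /\ meager (A `&` U)]) U).
Proof.
set G := [set U | _].
have [D mD] := ex_maximal_disjoint_subcollection id G.
have [DG tD _] := mD.
have mV : meager (A `&` \bigcup_(U in D) U).
  by apply: meager_trivIset_bigcup => // U /DG[].
have nd : nowhere_dense ((\bigcup_(U in G) U) `\` \bigcup_(U in D) U).
  apply: maximal_disjoint_nowhere_dense mD => [U []//|U V [_ mU] oV VU].
  by split=> //; apply: meager_subset mU; exact: setIS.
have mWV : meager ((\bigcup_(U in G) U) `\` \bigcup_(U in D) U).
  by exists (fun=> (\bigcup_(U in G) U) `\` \bigcup_(U in D) U);
    rewrite ?bigcup_const.
apply: meager_subset (meager_setU mV mWV) => x [Ax Wx].
by have [Vx|nVx] := pselect ((\bigcup_(U in D) U) x); [left|right].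
Qed.

End BanachCategory.

Theorem theorem3p6 (X : topologicalType) :
  relatively_complete (closed_classes X).
Proof.
move=> a; have [A ->] := mclass_surj a.
set W := \bigcup_(U in [set U | open U /\ meager (A `&` U)]) U.
exists (mclass (~` W)); split; last first.
  move=> _ [[F cF <-] /le_mclass mAF]; apply: le_mclass_subset.
  (* The complement of [F] is itself one of the open sets making up [W], so the complement of [W]
     lies in [F] outright, not just modulo a meager set. *)
  apply: subsetCl => x Fx; exists (~` F) => //.
  by split; [rewrite openC|rewrite -setDE].
split; last by apply/le_mclass; rewrite setDE setCK; exact: Banach_category.
by exists (~` W) => //=; rewrite closedC; apply: bigcup_open => U [].
Qed.
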